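(* Let $\mathfrak{b}\subset\mathfrak{g}=\mathfrak{gl}(n+1,\mathbb{C})$ be a Borel subalgebra with nilradical $\mathfrak{n}$, and suppose that the $K_{n+1}$-orbit of $\mathfrak{b}$ in $\mathcal{B}_{n+1}$ is not closed. Then $\pi_{\mathfrak{k}_{n+1}}(\mathfrak{n}^{reg})\cap\mathcal{N}_{\mathfrak{k}_{n+1}}=\emptyset$; that is, for no element $y\in\mathfrak{n}$ which is regular in $\mathfrak{g}$ is $\pi_{\mathfrak{k}_{n+1}}(y)$ nilpotent.
   Context: $n\ge1$. $\theta$ is the involution of $\mathfrak{g}$ given by conjugation by $\mathrm{diag}(1,\dots,1,-1)$; $\mathfrak{g}=\mathfrak{k}_{n+1}\oplus\mathfrak{p}_{n+1}$ is the decomposition into the $+1$ and $-1$ eigenspaces of $\theta$, so $\mathfrak{k}_{n+1}=\mathfrak{gl}(n,\mathbb{C})\oplus\mathfrak{gl}(1,\mathbb{C})$ is the block diagonal matrices with blocks of sizes $n$ and $1$. $\pi_{\mathfrak{k}_{n+1}}:\mathfrak{g}\to\mathfrak{k}_{n+1}$ is the projection along $\mathfrak{p}_{n+1}$, and $\mathcal{N}_{\mathfrak{k}_{n+1}}$ is the set of nilpotent elements of $\mathfrak{k}_{n+1}$. $K_{n+1}=GL(n,\mathbb{C})\times GL(1,\mathbb{C})$ is the corresponding group of invertible block diagonal matrices, acting by conjugation on the flag variety $\mathcal{B}_{n+1}$ of $\mathfrak{g}$. $\mathfrak{n}^{reg}$ denotes the set of elements of $\mathfrak{n}$ that are regular in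 $\mathfrak{g}$ (the regular nilpotent elements of $\mathfrak{b}$). *)

(* Defs.v *)
From HB Require Import structures.
From mathcomp Require Import all_boot all_order all_algebra.
From mathcomp Require Import reals.
From mathcomp Require Import complex.
Set Implicit Arguments. Unset Strict Implicit. Unset Printing Implicit Defensive.
Import Order.TTheory GRing.Theory Num.Theory.
Local Open Scope ring_scope.

Section GL.
Variables (R : realType) (N : nat).
Local Notation C := (R[i])%C.
Local Notation M := 'M[C]_N.+1.

Definition upper_tri (A : M) : Prop := forall i j : 'I_N.+1, (j < i)%N -> A i j = 0.
Definition strict_upper_tri (A : M) : Prop := forall i j : 'I_N.+1, (j <= i)%N -> A i j = 0.

(* the Borel subalgebra Ad(g) b0 = g b0 g^-1, for g in GL(N+1,C), as a set of matrices;
   every Borel subalgebra of gl(N+1,C) is of this form *)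
Definition borel (g : M) : M -> Prop := fun X => upper_tri (invmx g *m X *m g).
Definition nilrad (g : M) : M -> Prop := fun X => strict_upper_tri (invmx g *m X *m g).

(* K = GL(n) x GL(1): invertible block diagonal matrices (blocks n and 1) *)
Definition in_k (X : M) : Prop :=
  forall i j : 'I_N.+1, (i == ord_max) != (j == ord_max) -> X i j = 0.
Definition in_K (k : M) : Prop := k \in unitmx /\ in_k k.

Definition pi_k (X : M) : M :=
  \matrix_(i, j) (if (i == ord_max) == (j == ord_max) then X i j else 0).

Definition nilpotent (X : M) : Prop := exists m : nat, X ^+ m = 0.

(* regular in g: centralizer z_g(y) = ker ad(y) has dimension rank g = N+1 *)
Definition ad (y : M) : M -> M := fun X => y *m X - X *m y.
Definition regular (y : M) : Prop :=
  ((N.+1 * N.+1) - \rank (lin_mx (ad y)))%N = N.+1.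

(* preimage in GL(N+1,C) of the K-orbit of the Borel borel g under
   GL -> B_{N+1}, h |-> Ad(h) b0 *)
Definition orbit_preimage (g : M) (h : M) : Prop :=
  h \in unitmx /\ exists k : M, in_K k /\ (forall X, borel h X <-> borel (k *m g) X).

(* The flag variety B_{N+1} carries the quotient topology of GL(N+1,C)
   (with its classical topology as an open subset of M_{N+1}(C)); so a subset of
   B_{N+1} is closed iff its preimage is closed in GL(N+1,C). *)
Definition closed_in_GL (S : M -> Prop) : Prop :=
  forall h : M, h \in unitmx -> ~ S h ->
    exists eps : R, 0 < eps /\
      forall h' : M, h' \in unitmx ->
        (forall i j, `|h' i j - h i j| < (eps%:C)%C) -> ~ S h'.

Definition K_orbit_closed (g : M) : Prop := closed_in_GL (orbit_preimage g).

End GL.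

(* Main.v *)
(** Let [e] be the last basis vector, [W] the hyperplane spanned by the others, [E] the
projection onto [e] along [W], and [V_1 < V_2 < ...] the flag of [g]. If [y] and
[pi_k y] are both nilpotent, then their characteristic polynomials and Cramer's rule
show that the corner entry of the resolvent [(t - y)^-1] is [1 / t], i.e. [y ^ k e]
lies in [W] for every [k >= 1]. When [y] is regular in the nilradical of the Borel of
[g], all superdiagonal entries of [g^-1 y g] are nonzero, so if [i] is least with [e]
in [V_i], then [y e, ..., y ^ (i-1) e] span [V_(i-1)]. Hence [V_(i-1)] lies in [W]
and [e] lies in [V_i]; equivalently, [g^-1 E g] is upper triangular with its only
nonzero diagonal entry in position [i]. The flags with this property form a single
[K]-orbit, and the property is closed, being given by polynomial equations up to the
unit [det g]. So the orbit of [g] is closed. *)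

Require Import Defs.
From HB Require Import structures.
From mathcomp Require Import all_boot all_order all_algebra.
From mathcomp Require Import reals complex.
From mathcomp Require Import classical_sets topology normedtype.
From mathcomp Require Import zify.
Set Implicit Arguments. Unset Strict Implicit. Unset Printing Implicit Defensive.
Import Order.TTheory GRing.Theory Num.Theory.
Import numFieldNormedType.Exports.
Local Open Scope ring_scope.

(** * Characteristic polynomial and resolvent of a nilpotent matrix *)

Section NilpotentPowers.
Variables (F : fieldType) (n : nat).
Implicit Types A : 'M[F]_n.+1.

(** When [A ^+ m = 0], the geometric series gives [('X - A)^-1] as this sum divided by ['X^m]. *)
Definition resolvent_num A m : 'M[{poly F}]_n.+1 :=
  \sum_(k < m) ('X%:M : 'M_n.+1) ^+ (m.-1 - k) * map_mx polyC A ^+ k.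

Lemma char_poly_mx_resolvent A m :
  A ^+ m = 0 -> char_poly_mx A *m resolvent_num A m = ('X^m)%:M.
Proof.
move=> Am0; have cXA : GRing.comm ('X%:M : 'M_n.+1) (map_mx polyC A).
  by rewrite /GRing.comm -!mulmxE scalar_mxC.
have := subrXX_comm m cXA.
by rewrite -!rmorphXn /= Am0 map_mx0 subr0 => ->.
Qed.

(** Determinants in the resolvent identity show that [char_poly A] divides a power of ['X]. Being
    monic it is itself a power, and its degree fixes the exponent. *)
Lemma char_poly_nilpotent A m : A ^+ m = 0 -> char_poly A = 'X^(n.+1).
Proof.
move=> /char_poly_mx_resolvent /(congr1 determinant).
rewrite det_mulmx det_scalar -exprM -/(char_poly A) => detE.
have: char_poly A %| ('X - 0%:P) ^+ (m * n.+1).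
  by rewrite subr0 -detE dvdp_mulr.
case/dvdp_exp_XsubCP => k _; rewrite subr0.
rewrite eqp_monic ?char_poly_monic ?monicXn // => /eqP eqk.
by have := size_char_poly A; rewrite eqk size_polyXn => -[->].
Qed.

Lemma resolvent_numE A m i j :
  resolvent_num A m i j = \sum_(k < m) (A ^+ k) i j *: 'X^(m.-1 - k).
Proof.
rewrite /resolvent_num summxE; apply: eq_bigr => k _.
by rewrite -!rmorphXn /= -mulmxE mul_scalar_mx !mxE mulrC mul_polyC.
Qed.

(* The diagonal entries of the powers of [A] are the coefficients of a diagonal entry of
   [\adj ('X - A)]. *)
Lemma nilpotent_diag_powers A m i k :
    A ^+ m = 0 -> cofactor (char_poly_mx A) i i = 'X^n ->
  (0 < k)%N -> (A ^+ k) i i = 0.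
Proof.
move=> Am0 cofE k_gt0.
case: (leqP m k) => [le_mk | lt_km].
  by rewrite -(subnK le_mk) exprD Am0 mulr0 mxE.
have adjE : \adj (char_poly_mx A) *m ('X^m)%:M
             = 'X^(n.+1) *: resolvent_num A m.
  rewrite -(char_poly_mx_resolvent Am0) mulmxA mul_adj_mx.
  by rewrite -/(char_poly A) (char_poly_nilpotent Am0) mul_scalar_mx.
have m_gt0 : (0 < m)%N by apply: leq_trans lt_km.
(* Entry [(i, i)] of [adjE] reads ['X^n * 'X^m] on the left, and a factor ['X^(n.+1)] cancels. *)
have resE : resolvent_num A m i i = 'X^(m.-1).
  apply: (@mulfI _ 'X^(n.+1)); first by rewrite monic_neq0 ?monicXn.
  have := congr1 (fun B : 'M_n.+1 => B i i) adjE.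
  rewrite mul_mx_scalar !mxE cofE => <-.
  by rewrite -!exprD; congr (_ ^+ _); rewrite addSnnS prednK // addnC.
have <- : (resolvent_num A m i i)`_(m.-1 - k) = (A ^+ k) i i.
  rewrite resolvent_numE coef_sum (bigD1 (Ordinal lt_km)) //= big1 => [|j neq_jk].
    by rewrite addr0 coefZ coefXn eqxx mulr1.
  have lt_jm := ltn_ord j; move: neq_jk; rewrite -(inj_eq val_inj) /= => neq_jk.
  rewrite coefZ coefXn (_ : (m.-1 - k == m.-1 - j)%N = false) ?mulr0 //; lia.
rewrite resE coefXn (_ : (m.-1 - k == m.-1)%N = false) //; lia.
Qed.

End NilpotentPowers.

(** * Borel subalgebras and block-diagonal parts over a field *)

Section GL.
Variables (F : fieldType) (n : nat).
Local Notation M := 'M[F]_n.+1.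
Implicit Types (b g h k u x y z A B X : M) (i j p q r : 'I_n.+1).

(* The predicates of Defs over an arbitrary field; at [R[i]] they are convertible to the
   originals. *)
Definition upper_mx A : Prop := forall i j, (j < i)%N -> A i j = 0.

Definition strict_upper_mx A : Prop := forall i j, (j <= i)%N -> A i j = 0.

Definition in_borel g X : Prop := upper_mx (invmx g *m X *m g).

Definition in_nilrad g X : Prop := strict_upper_mx (invmx g *m X *m g).

Definition block_diag X : Prop :=
  forall i j, (i == ord_max) != (j == ord_max) -> X i j = 0.

Definition diag_part X : M :=
  \matrix_(i, j) (if (i == ord_max) == (j == ord_max) then X i j else 0).

Definition ad_mx y X : M := y *m X - X *m y.

Definition regular_mx y : Prop :=
  ((n.+1 * n.+1) - \rank (lin_mx (ad_mx y)))%N = n.+1.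

Definition same_orbit g h : Prop := exists k : M,
  (k \in unitmx /\ block_diag k) /\ forall X, in_borel h X <-> in_borel (k *m g) X.

(* The minor is the same for [y] and [diag_part y], and [char_poly (diag_part y)] is its
   product with ['X - y_max,max]. *)
Lemma cofactor_char_poly_mx_diag_part y m :
    diag_part y ^+ m = 0 ->
  cofactor (char_poly_mx y) ord_max ord_max = 'X^n.
Proof.
move=> /char_poly_nilpotent charE.
have -> : cofactor (char_poly_mx y) ord_max ord_max
        = cofactor (char_poly_mx (diag_part y)) ord_max ord_max.
  congr (_ * \det _); apply/matrixP=> a c; rewrite !mxE.
  by rewrite !(eq_sym (lift _ _) ord_max) !(negPf (neq_lift _ _)) eqxx.
have fact : ('X - (y ord_max ord_max)%:P)
    * cofactor (char_poly_mx (diag_part y)) ord_max ord_max = 'X^(n.+1).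
  rewrite -charE /char_poly (expand_det_row _ ord_max) (bigD1 ord_max) //=.
  rewrite big1 => [|j neq_j]; first by rewrite addr0 !mxE !eqxx.
  by rewrite !mxE eqxx eq_sym (negPf neq_j) subr0 mul0r.
(* Evaluating [fact] at this entry kills the left side, so a power of the entry is zero. *)
have yNN0 : y ord_max ord_max = 0.
  have := congr1 (fun p : {poly F} => p.[y ord_max ord_max]) fact.
  rewrite hornerM hornerXsubC subrr mul0r hornerXn => /esym/eqP.
  by rewrite expf_eq0 => /andP[_ /eqP].
apply: (@mulfI _ 'X); first by rewrite polyX_eq0.
by move: fact; rewrite yNN0 subr0 exprS.
Qed.

(** * Upper triangular matrices and the normalizer of a Borel subalgebra *)

Lemma upper_mx_mulmx A B : upper_mx A -> upper_mx B -> upper_mx (A *m B).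
Proof.
move=> uA uB i j lt_ji; rewrite mxE big1 // => r _.
case: (ltnP r i) => [/uA-> | le_ir]; first by rewrite mul0r.
by rewrite uB ?mulr0 // (leq_trans lt_ji).
Qed.

Lemma mulmx_upper_mx_diag A B i :
  upper_mx A -> upper_mx B -> (A *m B) i i = A i i * B i i.
Proof.
move=> uA uB; rewrite mxE (bigD1 i) //= big1 ?addr0 // => r neq_ri.
case: (ltngtP r i) => [/uA-> | /uB-> | /val_inj eq_ri].
- by rewrite mul0r.
- by rewrite mulr0.
- by rewrite eq_ri eqxx in neq_ri.
Qed.

Lemma det_upper_mx A : upper_mx A -> \det A = \prod_i A i i.
Proof.
move=> uA; rewrite -det_tr det_trig; first by apply: eq_bigr => i _; rewrite mxE.
by apply/is_trig_mxP => i j lt_ij; rewrite mxE uA.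
Qed.

Lemma upper_mx_unit_diag A i : upper_mx A -> A \in unitmx -> A i i != 0.
Proof.
move=> uA; rewrite unitmxE det_upper_mx // unitfE => /prodf_neq0; exact.
Qed.

(** Back substitution, from the last row of [B] upwards. *)
Lemma upper_mx_mulmx_cancel A B :
  (forall i, A i i != 0) -> upper_mx A -> upper_mx (A *m B) -> upper_mx B.
Proof.
move=> dA uA uAB i; have [d] := ubnP (n - i).
elim: d => // d IHd in i * => le_d j lt_ji.
have := uAB i j lt_ji; rewrite mxE (bigD1 i) //= big1 => [|r neq_ri].
  by move/eqP; rewrite addr0 mulf_eq0 (negPf (dA i)) => /eqP.
case: (ltngtP r i) => [/uA-> | lt_ir | /val_inj eq_ri].
- by rewrite mul0r.
- rewrite (IHd r) ?mulr0 //; last exact: ltn_trans lt_ir.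
  have := ltn_ord r; lia.
- by rewrite eq_ri eqxx in neq_ri.
Qed.

Lemma upper_mx_invmx b : b \in unitmx -> upper_mx b -> upper_mx (invmx b).
Proof.
move=> ub tb; apply: (upper_mx_mulmx_cancel _ tb) => [i|].
  exact: upper_mx_unit_diag.
rewrite mulmxV // => i j lt_ji; rewrite mxE.
by case: eqP => // eq_ij; rewrite eq_ij ltnn in lt_ji.
Qed.

Lemma invmxM g h : g \in unitmx -> h \in unitmx ->
  invmx (g *m h) = invmx h *m invmx g.
Proof.
move=> ug uh; have ugh : g *m h \in unitmx by rewrite unitmx_mul ug.
apply: (can_inj (mulKmx ugh)).
by rewrite (mulmxV ugh) mulmxA (mulmxK uh) (mulmxV ug).
Qed.

Lemma in_borel_mulr_upper_mx h b X :
    h \in unitmx -> b \in unitmx -> upper_mx b ->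
  in_borel (h *m b) X <-> in_borel h X.
Proof.
move=> uh ub tb; rewrite /in_borel invmxM //.
have -> : invmx b *m invmx h *m X *m (h *m b)
        = invmx b *m (invmx h *m X *m h *m b) by rewrite !mulmxA.
split=> [tX | tX]; last first.
  by apply: upper_mx_mulmx; [exact: upper_mx_invmx | exact: upper_mx_mulmx].
rewrite -[invmx h *m X *m h](mulmxK ub).
apply: upper_mx_mulmx; last exact: upper_mx_invmx.
by rewrite -[_ *m b](mulKVmx ub); exact: upper_mx_mulmx.
Qed.

(* Let [u p a] be nonzero with [a < p], the rows below [p] vanishing left of the diagonal.
   For [A = delta_mx a p] and [B = u A u^-1], row [p] of [u A = B u] is a nonzero multiple
   of the basis row [p], and also a combination of the rows [p], [p+1], ... of [u];
   columns [a] and [p] show that this is impossible. *)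
Lemma upper_mx_normalizer u :
    u \in unitmx ->
    (forall A, upper_mx A -> upper_mx (u *m A *m invmx u)) ->
  upper_mx u.
Proof.
move=> uu normu p; have [d] := ubnP (n - p).
elim: d => // d IHd in p * => le_d a lt_ap.
have below (r c : 'I_n.+1) : (p < r)%N -> (c < r)%N -> u r c = 0.
  by move=> lt_pr; apply: IHd; have := ltn_ord r; lia.
apply/eqP/negPn/negP => u_pa.
set A : M := delta_mx a p; set B := u *m A *m invmx u.
have tB : upper_mx B.
  apply: normu => i j lt_ji; rewrite mxE.
  by case: andP => // -[/eqP ei /eqP ej]; move: lt_ji lt_ap; rewrite ei ej; lia.
have uA r c : (u *m A) r c = u r a *+ (c == p).
  rewrite mxE (bigD1 a) //= big1 => [|s neq_sa]; last first.
    by rewrite mxE (negPf neq_sa) mulr0.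
  by rewrite mxE eqxx /= addr0 mulr_natr.
have rowE (c : 'I_n.+1) : u p a *+ (c == p)
    = B p p * u p c + \sum_(r : 'I_n.+1 | (p < r)%N) B p r * u r c.
  rewrite -uA -[u *m A](mulmxKV uu) -/B mxE (bigD1 p) //=; congr (_ + _).
  rewrite [LHS]big_mkcond [RHS]big_mkcond; apply: eq_bigr => r _.
  case: (ltngtP p r) => [|lt_rp|/val_inj->]; last by rewrite eqxx.
    by case: eqP => // ->; rewrite ltnn.
  by rewrite tB // mul0r if_same.
have Bpp0 : B p p = 0.
  have := rowE a; rewrite big1 => [|r lt_pr]; last first.
    by rewrite below ?mulr0 // (ltn_trans lt_ap).
  have -> : (a == p) = false by apply/eqP => eq_ap; rewrite eq_ap ltnn in lt_ap.
  by move/esym/eqP; rewrite addr0 mulf_eq0 (negPf u_pa) orbF => /eqP.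
have := rowE p; rewrite eqxx Bpp0 mul0r add0r big1 => [/eqP|r lt_pr].
  by rewrite (negPf u_pa).
by rewrite below ?mulr0.
Qed.

(** * Splitting position of a flag as an invariant of its orbit *)

Local Notation E := (delta_mx ord_max ord_max : M).

(** [upper_mx (line_proj h)] unfolds to [in_borel h E], so it depends only on the Borel
    subalgebra. *)
Definition line_proj h : M := invmx h *m E *m h.

(* In terms of the flag [V] spanned by the columns of [h]: [V_i] (counting from 0) lies in
   the hyperplane where the last coordinate vanishes, and the last basis vector lies in
   [V_(i+1)]. *)
Definition splits_at i h := strict_upper_mx (line_proj h - delta_mx i i).

Lemma line_projE h p q : line_proj h p q = invmx h p ord_max * h ord_max q.
Proof.
rewrite /line_proj !mxE (bigD1 ord_max) //= big1 => [|r neq_r].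
  rewrite addr0 !mxE (bigD1 ord_max) //= big1 => [|r neq_r].
    by rewrite mxE !eqxx mulr1 addr0.
  by rewrite mxE (negPf neq_r) mulr0.
rewrite !mxE big1 ?mul0r // => s _.
by rewrite mxE (negPf neq_r) andbF mulr0.
Qed.

Lemma line_proj_idem h : h \in unitmx -> line_proj h *m line_proj h = line_proj h.
Proof.
move=> uh; rewrite /line_proj !mulmxA (mulmxK uh) -(mulmxA _ E E).
by rewrite mul_delta_mx.
Qed.

Lemma sub_delta_mxE A i p q :
  (A - delta_mx i i) p q = A p q - ((p == i) && (q == i))%:R.
Proof. by rewrite !mxE. Qed.

Lemma splits_atP i h :
  splits_at i h <->
  upper_mx (line_proj h) /\ forall p, line_proj h p p = (p == i)%:R.
Proof.
have off_diag (p q : 'I_n.+1) : (q < p)%N -> (p == i) && (q == i) = false.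
  move=> lt_qp; apply/negP => /andP[/eqP ep /eqP eq].
  by rewrite ep eq ltnn in lt_qp.
split=> [spl | [up diag] p q].
  split=> [p q lt_qp | p].
    by have := spl p q (ltnW lt_qp); rewrite sub_delta_mxE off_diag // subr0.
  have := spl p p (leqnn p); rewrite sub_delta_mxE andbb => /eqP.
  by rewrite subr_eq0 => /eqP.
rewrite leq_eqVlt => /orP[/eqP/val_inj-> | lt_qp].
  by rewrite sub_delta_mxE diag andbb subrr.
by rewrite sub_delta_mxE up // off_diag // subrr.
Qed.

Lemma block_diagP k : block_diag k <-> k *m E = E *m k.
Proof.
have kE r c : (k *m E) r c = k r ord_max * (c == ord_max)%:R.
  rewrite mxE (bigD1 ord_max) //= big1 ?mxE ?eqxx ?addr0 // => s neq_s.
  by rewrite mxE (negPf neq_s) mulr0.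
have Ek r c : (E *m k) r c = (r == ord_max)%:R * k ord_max c.
  rewrite mxE (bigD1 ord_max) //= big1 ?mxE ?eqxx ?andbT ?addr0 // => s neq_s.
  by rewrite mxE (negPf neq_s) andbF mul0r.
split=> [kk | comm i j].
  apply/matrixP => r c; rewrite kE Ek.
  case: (altP (r =P ord_max)) (altP (c =P ord_max)) => [->|neq_r] [->|neq_c].
  - by rewrite mulr1 mul1r.
  - by rewrite mulr0 mul1r kk // eqxx eq_sym (negPf neq_c).
  - by rewrite mul0r mulr1 kk // eqxx (negPf neq_r).
  - by rewrite mulr0 mul0r.
have := congr1 (fun A : M => A i j) comm; rewrite /= kE Ek.
case: (altP (i =P ord_max)) (altP (j =P ord_max)) => [->|neq_r] [->|neq_c] //.
  by rewrite mulr0 mul1r => <-.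
by rewrite mul0r mulr1 => ->.
Qed.

(** Both sides reduce to [B *m A], since [(1 - A) A] and [B (1 - B)] vanish. *)
Lemma mulmx_intertwiner A B : A *m A = A -> B *m B = B ->
  (B *m A + (1%:M - B) *m (1%:M - A)) *m A
    = B *m (B *m A + (1%:M - B) *m (1%:M - A)).
Proof.
move=> idA idB; have A0 : (1%:M - A) *m A = 0 by rewrite mulmxBl mul1mx idA subrr.
have B0 : B *m (1%:M - B) = 0 by rewrite mulmxBr mulmx1 idB subrr.
rewrite (mulmxDl (B *m A)) (mulmxDr B (B *m A)) -(mulmxA B A A).
rewrite -(mulmxA (1%:M - B)) idA A0 mulmx0.
by rewrite (mulmxA B B) (mulmxA B (1%:M - B)) idB B0 mul0mx.
Qed.

Lemma mulmx_conj_comm A b g h : g \in unitmx -> h \in unitmx ->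
    b *m (invmx g *m A *m g) = (invmx h *m A *m h) *m b ->
  h *m b *m invmx g *m A = A *m (h *m b *m invmx g).
Proof.
move=> ug uh /(congr1 (fun X => h *m X *m invmx g)).
by rewrite !mulmxA (mulmxV uh) mul1mx (mulmxK ug).
Qed.

(* With [P] and [Q] the projections attached to [g] and [h], the unitriangular matrix
   [b = Q P + (1 - Q) (1 - P)] satisfies [b P = Q b], so that [k = h b g^-1] commutes
   with [E]. *)
Lemma splits_at_same_orbit i g h :
    g \in unitmx -> h \in unitmx -> splits_at i g -> splits_at i h ->
  same_orbit g h.
Proof.
move=> ug uh /splits_atP[tP dP] /splits_atP[tQ dQ].
have idP := line_proj_idem ug; have idQ := line_proj_idem uh.
set P := line_proj g in tP dP idP; set Q := line_proj h in tQ dQ idQ.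
have t1 A : upper_mx A -> upper_mx (1%:M - A).
  move=> tA r c lt_cr; rewrite 3!mxE tA // subr0.
  by case: eqP => // eq_rc; rewrite eq_rc ltnn in lt_cr.
pose b : M := Q *m P + (1%:M - Q) *m (1%:M - P).
have tb : upper_mx b.
  move=> r c lt_cr; rewrite mxE.
  by rewrite (upper_mx_mulmx tQ tP) // (upper_mx_mulmx (t1 _ tQ) (t1 _ tP)) // addr0.
have db r : b r r = 1.
  rewrite mxE (mulmx_upper_mx_diag r tQ tP).
  rewrite (mulmx_upper_mx_diag r (t1 _ tQ) (t1 _ tP)).
  have d1 A : (1%:M - A) r r = 1 - A r r by rewrite 3!mxE eqxx.
  rewrite !d1 dP dQ; case: eqP => _; first by rewrite mulr1 subrr mul0r addr0.
  by rewrite mulr0 subr0 mulr1 add0r.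
have ub : b \in unitmx.
  by rewrite unitmxE det_upper_mx // big1 ?unitr1.
have bP : b *m P = Q *m b := mulmx_intertwiner idP idQ.
have kgE : h *m b *m invmx g *m g = h *m b by rewrite mulmxKV.
exists (h *m b *m invmx g); split; last first.
  by move=> X; rewrite kgE; exact: iff_sym (in_borel_mulr_upper_mx _ uh ub tb).
split; first by rewrite !unitmx_mul uh ub unitmx_inv ug.
apply/block_diagP; exact: mulmx_conj_comm.
Qed.

(** Equality of the two Borel subalgebras makes [u = h^-1 k g] normalize the upper triangular
    matrices, so [u] is upper triangular. As [k] commutes with [E], [u] intertwines the two
    projections, and their diagonals agree. *)
Lemma same_orbit_splits_at i g h :
    g \in unitmx -> h \in unitmx -> same_orbit g h -> splits_at i g ->
  splits_at i h.
Proof.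
move=> ug uh [k [[uk /block_diagP kE] borelE]] /splits_atP[tP dP].
have ukg : k *m g \in unitmx by rewrite unitmx_mul uk.
pose u := invmx h *m (k *m g).
have uu : u \in unitmx by rewrite unitmx_mul unitmx_inv uh.
have uhV : invmx h \in unitmx by rewrite unitmx_inv.
have uV : invmx u = invmx (k *m g) *m h by rewrite /u (invmxM uhV ukg) invmxK.
have tu : upper_mx u.
  apply: (upper_mx_normalizer uu) => A tA.
  have /(borelE _).2 : in_borel (k *m g) (k *m g *m A *m invmx (k *m g)).
    by rewrite /in_borel -(mulmxA (k *m g)) (mulKmx ukg) (mulmxKV ukg).
  rewrite /in_borel uV /u !mulmxA; exact.
have tQ : upper_mx (line_proj h).
  apply: (borelE E).2.
  have kEV : invmx k *m E *m k = E by rewrite -mulmxA -kE (mulKmx uk).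
  rewrite /in_borel (invmxM uk ug).
  have -> : invmx g *m invmx k *m E *m (k *m g)
          = invmx g *m (invmx k *m E *m k) *m g by rewrite !mulmxA.
  by rewrite kEV.
apply/splits_atP; split=> [|p]; first exact: tQ.
have Qu : line_proj h *m u = u *m line_proj g.
  rewrite /line_proj /u !mulmxA (mulmxK uh) (mulmxK ug).
  by rewrite -(mulmxA _ E k) -kE mulmxA.
have := congr1 (fun A : M => A p p) Qu.
rewrite (mulmx_upper_mx_diag p tQ tu) (mulmx_upper_mx_diag p tu tP) mulrC dP.
apply: mulfI; exact: upper_mx_unit_diag.
Qed.

(** * Rank of [ad] and superdiagonal entries of regular nilpotents *)

Fact ad_is_linear y : linear (ad_mx y).
Proof.
move=> a A B; rewrite /ad_mx mulmxDr mulmxDl -scalemxAr -scalemxAl.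
by rewrite scalerBr addrACA opprD.
Qed.
HB.instance Definition _ y :=
  GRing.isLinear.Build F M M _ (ad_mx y) (ad_is_linear y).

Lemma ad_conj g y X : g \in unitmx ->
  ad_mx y X = g *m ad_mx (invmx g *m y *m g) (invmx g *m X *m g) *m invmx g.
Proof.
move=> ug; have gV A : g *m (invmx g *m A *m g) = A *m g.
  by rewrite -mulmxA (mulKVmx ug).
have conjM A B : g *m ((invmx g *m A *m g) *m (invmx g *m B *m g)) *m invmx g = A *m B.
  by rewrite (mulmxA g) (gV A) -(mulmxA A g) (gV B) mulmxA (mulmxK ug).
by rewrite /ad_mx mulmxBr mulmxBl !conjM.
Qed.

(** [ad y] is [ad z] composed on both sides with conjugations, and composition cannot raise the
    rank. *)
Lemma mxrank_ad_conj g y :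
  g \in unitmx ->
  (\rank (lin_mx (ad_mx y)) <= \rank (lin_mx (ad_mx (invmx g *m y *m g))))%N.
Proof.
move=> ug; set z := invmx g *m y *m g.
have -> : lin_mx (ad_mx y) = lin_mx (mulmxr g \o mulmx (invmx g)) *m lin_mx (ad_mx z)
    *m lin_mx (mulmxr (invmx g) \o mulmx g).
  apply/row_matrixP => k; rewrite !rowE !mulmxA -[delta_mx 0 k]vec_mxK.
  by rewrite !mul_vec_lin /= -(ad_conj _ _ ug).
exact: leq_trans (mxrankM_maxl _ _) (mxrankM_maxr _ _).
Qed.

(* [ad z] maps the parabolic subalgebra of upper triangular matrices extended by the
   entry [(b, a)] into its nilradical, the strictly upper triangular matrices vanishing at
   [(a, b)]. So its rank is at most the number of positions outside the former ([T]) plus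
   the number of positions of the latter ([S]). *)
Lemma mxrank_ad_superdiag z (a b : 'I_n.+1) :
    strict_upper_mx z -> b = a.+1 :> nat -> z a b = 0 ->
  (\rank (lin_mx (ad_mx z)) + n.+2 <= n.+1 * n.+1)%N.
Proof.
move=> sz eq_ba zab0.
pose T (x : 'I_n.+1 * 'I_n.+1) := (x.2 < x.1)%N && (x != (b, a)).
pose S (x : 'I_n.+1 * 'I_n.+1) := (x.1 < x.2)%N && (x != (a, b)).
have z_supp p r : z p r != 0 -> S (p, r).
  move=> zpr; rewrite /S /=; apply/andP; split.
    by rewrite ltnNge; apply: contraNN zpr => /sz ->.
  by apply: contraNneq zpr => -[-> ->]; rewrite zab0.
have pairE (x y : 'I_n.+1 * 'I_n.+1) :
    (x == y) = (x.1 == y.1 :> nat) && (x.2 == y.2 :> nat) by [].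
(* The only possible terms are [z p r] (if [q = c]) and [z c q] (if [p = r]). Each vanishes
   separately, because no index lies strictly between [a] and [b]. *)
have ad_supp r c p q : ~~ T (r, c) -> ~~ S (p, q) -> ad_mx z (delta_mx r c) p q = 0.
  move=> notT notS; rewrite /ad_mx !mxE (bigD1 r) //= big1; last first.
    by move=> s /negPf neq_sr; rewrite mxE neq_sr mulr0.
  rewrite [X in _ - X](bigD1 c) //= [X in _ - (_ + X)]big1; last first.
    by move=> s /negPf neq_sc; rewrite mxE neq_sc andbF mul0r.
  rewrite !mxE !eqxx !addr0 andbT; apply/eqP; rewrite subr_eq0; apply/eqP.
  transitivity (0 : F).
    case: (altP (q =P c)) => [eq_qc|_]; last by rewrite mulr0.
    apply/eqP; rewrite mulr1; apply: contraT => /z_supp.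
    by move: notT notS; rewrite /T /S !pairE eq_qc /=; lia.
  case: (altP (p =P r)) => [eq_pr|_]; last by rewrite mul0r.
  apply/esym/eqP; rewrite mul1r; apply: contraT => /z_supp.
  by move: notT notS; rewrite /T /S !pairE eq_pr /=; lia.
pose idx (x : 'I_n.+1 * 'I_n.+1) := mxvec_index x.1 x.2.
(* The first sum holds the images of the matrix units in [T]; the second is a coordinate space
   containing the images of all the others. *)
pose W := ((\sum_(x | T x) <<row (idx x) (lin_mx (ad_mx z))>>)
   + (\sum_(x | S x) <<delta_mx 0 (idx x) : 'rV[F]_(n.+1 * n.+1)>>))%MS.
have sub_W : (lin_mx (ad_mx z) <= W)%MS.
  apply/row_subP => k; case/mxvec_indexP: k => r c.
  have [Trc | notT] := boolP (T (r, c)).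
    apply: submx_trans (addsmxSl _ _).
    by apply: (sumsmx_sup (r, c)); rewrite // genmxE.
  apply: submx_trans (addsmxSr _ _).
  have -> : row (mxvec_index r c) (lin_mx (ad_mx z)) = mxvec (ad_mx z (delta_mx r c)).
    by rewrite rowE -mxvec_delta mul_vec_lin.
  rewrite [X in mxvec X]matrix_sum_delta linear_sum summx_sub // => p _.
  rewrite linear_sum summx_sub //= => q _.
  have [Spq | notS] := boolP (S (p, q)); last by rewrite ad_supp // scale0r linear0 sub0mx.
  apply: (sumsmx_sup (p, q)) => //; rewrite genmxE linearZ /= mxvec_delta.
  exact: scalemx_sub.
have rank_sum (P : pred ('I_n.+1 * 'I_n.+1))
    (A : 'I_n.+1 * 'I_n.+1 -> 'rV[F]_(n.+1 * n.+1)) :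
    (\rank (\sum_(x | P x) <<A x>>)%MS <= \sum_(x | P x) 1)%N.
  elim/big_ind2: _ => [|B1 k1 B2 k2 le1 le2|x _]; first by rewrite mxrank0.
    exact: leq_trans (mxrank_adds_leqif _ _).1 (leq_add le1 le2).
  by rewrite mxrank_gen rank_leq_row.
have rank_le : (\rank (lin_mx (ad_mx z)) <= \sum_(x | T x) 1 + \sum_(x | S x) 1)%N.
  apply: leq_trans (mxrankS sub_W) _.
  exact: leq_trans (mxrank_adds_leqif _ _).1 (leq_add (rank_sum _ _) (rank_sum _ _)).
have diagE : (\sum_(x : 'I_n.+1 * 'I_n.+1) (x.1 == x.2) = n.+1)%N.
  rewrite -(pair_big xpredT xpredT (fun r c => (r == c) : nat)) /=.
  rewrite (eq_bigr (fun=> 1%N)) ?sum1_card ?card_ord // => r _.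
  by rewrite (bigD1 r) //= eqxx big1 // => c; rewrite eq_sym => /negPf->.
have ptE : (\sum_(x : 'I_n.+1 * 'I_n.+1) (x == (b, a)) = 1)%N.
  by rewrite (bigD1 (b, a)) //= eqxx big1 // => c /negPf->.
have totE : (\sum_(x : 'I_n.+1 * 'I_n.+1) 1 = n.+1 * n.+1)%N.
  by rewrite sum1_card card_prod card_ord.
apply: leq_trans (leq_add rank_le (leqnn _)) _.
(* [T], [S], the diagonal and [(b, a)] are pairwise disjoint sets of positions; the last two account
   for [n.+2]. *)
rewrite -[n.+2]addn1 -totE.
suff : (\sum_(x | T x) 1 + \sum_(x | S x) 1
    + (\sum_(x : 'I_n.+1 * 'I_n.+1) (x.1 == x.2)
       + \sum_(x : 'I_n.+1 * 'I_n.+1) (x == (b, a)))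
    <= \sum_(x : 'I_n.+1 * 'I_n.+1) 1)%N by rewrite diagE ptE.
rewrite (big_mkcond T) (big_mkcond S) /=.
rewrite -!big_split /=; apply: leq_sum => -[r c] _.
have ifE (B : bool) : (if B then 1 else 0)%N = B by case: B.
rewrite !ifE /T /S !pairE -(inj_eq val_inj) /=; lia.
Qed.

(** A zero on the superdiagonal would give [y] a centralizer of dimension at least [n.+2]. *)
Lemma regular_superdiag g y (a b : 'I_n.+1) :
    g \in unitmx -> in_nilrad g y -> regular_mx y -> b = a.+1 :> nat ->
  (invmx g *m y *m g) a b != 0.
Proof.
move=> ug ny; rewrite /regular_mx => reg eq_ba; apply/eqP => zab0.
have := leq_add (mxrank_ad_conj y ug) (leqnn n.+2).
by have := mxrank_ad_superdiag ny eq_ba zab0; lia.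
Qed.

(** * From nilpotent block-diagonal part to splitting of the flag *)

Lemma conj_exp g y (k : nat) :
  g \in unitmx -> (invmx g *m y *m g) ^+ k = invmx g *m y ^+ k *m g.
Proof.
move=> ug; elim: k => [|k IHk]; first by rewrite !expr0 mulmx1 mulVmx.
by rewrite !exprS IHk -!mulmxE !mulmxA mulmxK.
Qed.

Lemma strict_upper_mx_exp z (k : nat) p q :
  strict_upper_mx z -> (q < p + k)%N -> (z ^+ k) p q = 0.
Proof.
move=> sz; elim: k p => [|k IHk] p lt_q.
  rewrite expr0 mxE; case: eqP => // eq_pq.
  by move: lt_q; rewrite eq_pq addn0 ltnn.
rewrite exprS -mulmxE mxE big1 // => r _.
have [/sz-> | lt_pr] := leqP r p; first by rewrite mul0r.
by rewrite IHk ?mulr0 //; lia.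
Qed.

Lemma in_nilrad_nilpotent g y : g \in unitmx -> in_nilrad g y ->
  y ^+ n.+1 = 0.
Proof.
move=> ug ny; have z0 : (invmx g *m y *m g) ^+ n.+1 = 0.
  apply/matrixP => p q; rewrite [RHS]mxE strict_upper_mx_exp //.
  by have := ltn_ord q; lia.
have /esym/(congr1 (fun X => g *m X *m invmx g)) := conj_exp y n.+1 ug.
by rewrite z0 mulmx0 mul0mx -(mulmxA (invmx g)) (mulKVmx ug) (mulmxK ug).
Qed.

(** Each factor [z] moves the last nonzero coordinate up by one place and scales it by a
    superdiagonal entry. Writing [p + k] avoids truncated subtraction. *)
Lemma exp_mulmx_lead z (v : 'cV[F]_n.+1) i (k : nat) :
    strict_upper_mx z ->
    (forall a b : 'I_n.+1, b = a.+1 :> nat -> z a b != 0) ->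
    v i 0 != 0 -> (forall p, (i < p)%N -> v p 0 = 0) ->
  (forall p, (i < p + k)%N -> (z ^+ k *m v) p 0 = 0)
  /\ (forall p, (p + k = i)%N -> (z ^+ k *m v) p 0 != 0).
Proof.
move=> sz sd vi v0; elim: k => [|k [IH0 IH1]].
  rewrite expr0 mul1mx; split=> p; rewrite addn0; first exact: v0.
  by move=> /val_inj->.
rewrite exprS -mulmxE -mulmxA; split=> p lt_ip; rewrite mxE.
  rewrite big1 // => r _.
  have [/sz-> | lt_pr] := leqP r p; first by rewrite mul0r.
  by rewrite IH0 ?mulr0 //; lia.
have lt_p1 : (p.+1 < n.+1)%N by have := ltn_ord i; lia.
rewrite (bigD1 (Ordinal lt_p1)) //= big1 => [|r neq_r].
  by rewrite addr0 mulf_neq0 ?sd ?IH1 //=; lia.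
have [/sz-> | lt_pr] := leqP r p; first by rewrite mul0r.
by rewrite IH0 ?mulr0 //; move: neq_r; rewrite -(inj_eq val_inj) /=; lia.
Qed.

Lemma regular_nilpotent_diag_part_splits g y m :
    g \in unitmx -> in_nilrad g y -> regular_mx y -> diag_part y ^+ m = 0 ->
  exists i, splits_at i g.
Proof.
move=> ug ny reg pi_m.
have diag0 (k : nat) : (0 < k)%N -> (y ^+ k) ord_max ord_max = 0.
  apply: nilpotent_diag_powers (in_nilrad_nilpotent ug ny) _.
  exact: cofactor_char_poly_mx_diag_part pi_m.
(* [v] holds the coordinates of the last basis vector in the basis of columns of [g]; row [ord_max]
   of [g] is the last-coordinate functional in that basis. *)
pose v := col ord_max (invmx g); pose z := invmx g *m y *m g.
have psi_v (k : nat) : (y ^+ k) ord_max ord_max = \sum_r g ord_max r * (z ^+ k *m v) r 0.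
  transitivity ((g *m (z ^+ k *m v)) ord_max 0); last by rewrite mxE.
  rewrite /v colE (conj_exp _ _ ug) !mulmxA (mulmxV ug) mul1mx (mulmxK ug).
  by rewrite -colE [RHS]mxE.
have psi_v0 : \sum_r g ord_max r * v r 0 = 1.
  by have := psi_v 0; rewrite expr0 mul1mx mxE eqxx => <-.
have [i0 vi0] : exists i, v i 0 != 0.
  apply/existsP; apply: contraTT (oner_neq0 F) => /existsPn v0.
  rewrite negbK -psi_v0 big1 // => r _.
  by have := v0 r; rewrite negbK => /eqP->; rewrite mulr0.
case: (@arg_maxnP _ i0 (fun i => v i 0 != 0) val vi0) => i vi i_max.
have v_gt p : (i < p)%N -> v p 0 = 0.
  by move=> lt_ip; apply/eqP; apply: contraTT lt_ip => /i_max; rewrite -leqNgt.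
(* [z ^+ (i - q) *m v] ends at coordinate [q], and by induction the functional vanishes before [q],
   so [psi_v] reduces to its single term at [q]. *)
have psi_lt q : (q < i)%N -> g ord_max q = 0.
  have [d] := ubnP q; elim: d => // d IHd in q * => le_q lt_qi.
  have [z_gt z_lead] := exp_mulmx_lead (i - q) ny
    (fun r s => @regular_superdiag g y r s ug ny reg) vi v_gt.
  have := psi_v (i - q)%N; rewrite diag0 ?subn_gt0 // (bigD1 q) //= big1.
    move/esym/eqP; rewrite addr0 mulf_eq0 => /orP[/eqP // |].
    by rewrite (negPf (z_lead q _)) // subnKC // ltnW.
  move=> r neq_rq; have [lt_rq | le_qr] := ltnP r q.
    by rewrite IHd ?mul0r //; lia.
  by rewrite z_gt ?mulr0 //; move: neq_rq; rewrite -(inj_eq val_inj) /=; lia.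
(* Entry [(p, q)] is [v p 0 * g ord_max q], zero unless [p <= i <= q]. With [q <= p] only
   [p = q = i] remains, where [psi_v0] makes the product 1. *)
exists i => p q le_qp; rewrite sub_delta_mxE line_projE.
have -> : invmx g p ord_max = v p 0 by rewrite mxE.
have [lt_ip | le_pi] := ltnP i p.
  rewrite v_gt // mul0r; case: eqP => [eq_pi|_]; last by rewrite subr0.
  by rewrite eq_pi ltnn in lt_ip.
have [lt_qi | le_iq] := ltnP q i.
  rewrite psi_lt // mulr0; case: (q =P i) => [eq_qi|_]; last by rewrite andbF subr0.
  by rewrite eq_qi ltnn in lt_qi.
have -> : p = i by apply/val_inj/eqP; rewrite eqn_leq le_pi (leq_trans le_iq).
have -> : q = i by apply/val_inj/eqP; rewrite eqn_leq (leq_trans le_qp).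
rewrite !eqxx; apply/eqP; rewrite subr_eq0 -psi_v0 (bigD1 i) //= big1.
  by rewrite addr0 mulrC.
move=> r neq_ri; have [lt_ri | le_ir] := ltnP r i; first by rewrite psi_lt ?mul0r.
by rewrite v_gt ?mulr0 //; move: neq_ri; rewrite -(inj_eq val_inj) /=; lia.
Qed.

End GL.

(** * The splitting condition is closed *)

Section Continuity.
Variables (K : numFieldType) (n : nat).
Local Notation M := 'M[K]_n.+1.

Lemma continuous_neq0_near (f : M -> K) (h : M) :
    continuous f -> f h != 0 ->
  exists2 eps : K, 0 < eps &
    forall h' : M, (forall i j, `|h' i j - h i j| < eps) -> f h' != 0.
Proof.
move=> cf fh0; have fh_gt0 : 0 < `|f h| by rewrite normr_gt0.
have /nbhs_ballP[e /= e0 He] : nbhs h [set t | `|f h - f t| < `|f h|]%classic.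
  exact: (@cvgr_dist_lt _ _ _ _ _ _ _ (cf h)).
exists e => // h' hh'.
have /He /= : ball h e h'.
  by split=> // i j; rewrite -ball_normE /= distrC; exact: hh'.
by apply: contraTneq => ->; rewrite subr0 ltxx.
Qed.

Lemma continuous_mul (T : topologicalType) (f g : T -> K) :
  continuous f -> continuous g -> continuous (fun x => f x * g x).
Proof. by move=> cf cg x; apply: cvgM; [exact: cf | exact: cg]. Qed.

Lemma continuous_sub (T : topologicalType) (f g : T -> K) :
  continuous f -> continuous g -> continuous (fun x => f x - g x).
Proof. by move=> cf cg x; apply: cvgB; [exact: cf | exact: cg]. Qed.

Lemma continuous_det (T : topologicalType) m (f : T -> 'M[K]_m) :
  (forall i j, continuous (fun x => f x i j)) -> continuous (fun x => \det (f x)).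
Proof.
move=> cf; apply: continuous_big => [|s _ x]; first exact: add_continuous.
apply: cvgM; first exact: cvg_cst.
by apply: continuous_big => [|i _]; [exact: mul_continuous | exact: cf].
Qed.

Lemma continuous_adj_entry (i j : 'I_n.+1) : continuous (fun h : M => (\adj h) i j).
Proof.
have -> : (fun h : M => (\adj h) i j)
        = (fun h => (-1) ^+ (j + i) * \det (row' j (col' i h))).
  by apply/boolp.funext => h; rewrite mxE.
have cdet : continuous (fun h : M => \det (row' j (col' i h))).
  apply: continuous_det => a b.
  have -> : (fun h : M => row' j (col' i h) a b)
          = (fun h => h (lift j a) (lift i b)).
    by apply/boolp.funext => A; rewrite !mxE.
  exact: coord_continuous.
by apply: continuous_mul; [move=> h; exact: cst_continuous | exact: cdet].
Qed.

(** For invertible [h] and [c = d = ord_max] this is [\det h] times [line_proj h i j - a]. Clearing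
    the denominator leaves a polynomial, continuous on all matrices. *)
Lemma continuous_line_proj_num (i j c d : 'I_n.+1) (a : K) :
  continuous (fun h : M => (\adj h) i c * h d j - \det h * a).
Proof.
have cadj := continuous_mul (@continuous_adj_entry i c) (@coord_continuous K _ _ d j).
have cdet : continuous (fun h : M => \det h).
  by apply: continuous_det => *; exact: coord_continuous.
exact: continuous_sub cadj (continuous_mul cdet (@cst_continuous M K a)).
Qed.

(** Failure is witnessed by one nonzero entry on or below the diagonal; its polynomial numerator
    stays nonzero nearby. *)
Lemma not_splits_at_near (i : 'I_n.+1) (h : M) :
    h \in unitmx -> ~ splits_at i h ->
  exists2 eps : K, 0 < eps &
    forall h' : M, h' \in unitmx -> (forall p q, `|h' p q - h p q| < eps) ->
      ~ splits_at i h'.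
Proof.
move=> uh nspl.
pose num (A : M) p q := (\adj A) p ord_max * A ord_max q - \det A * delta_mx i i p q.
have numE (A : M) p q : A \in unitmx ->
    num A p q = \det A * (line_proj A - delta_mx i i) p q.
  move=> uA; rewrite /num sub_delta_mxE mulrBr line_projE /invmx uA !mxE !mulrA.
  by rewrite mulfV ?mul1r // -unitfE -unitmxE.
have det_h : \det h != 0 by rewrite -unitfE -unitmxE.
have [p /existsP[q]] : exists p : 'I_n.+1,
    [exists q : 'I_n.+1, (q <= p)%N && (num h p q != 0)].
  apply/existsP; apply: contra_notT nspl; rewrite negb_exists => /forallP num0.
  move=> p q le_qp; have /existsPn/(_ q) := num0 p.
  rewrite le_qp /= negbK (numE _ _ _ uh).
  by rewrite mulf_eq0 (negPf det_h) => /eqP.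
case/andP=> le_qp num_neq0.
have [eps eps_gt0 near_h] := continuous_neq0_near
  (@continuous_line_proj_num p q ord_max ord_max (delta_mx i i p q)) num_neq0.
exists eps => // h' uh' close spl'.
suff : num h' p q != 0 by rewrite numE // spl' // mulr0 eqxx.
exact: near_h.
Qed.

End Continuity.

(** * Closedness of the orbit *)

Theorem theorem3p7 (R : realType) (n : nat) (hn : (1 <= n)%N)
  (g : 'M[(R[i])%C]_n.+1) (hg : g \in unitmx) :
  ~ K_orbit_closed g ->
  forall y : 'M[(R[i])%C]_n.+1,
    nilrad g y -> regular y -> ~ nilpotent (pi_k y).
Proof.
move=> not_closed y ny reg [m pi_m]; apply: not_closed.
have [i spl_g] : exists i, splits_at i g.
  exact: (@regular_nilpotent_diag_part_splits _ _ g y m hg ny reg pi_m).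
(* The preimage of the orbit is the locus [splits_at i] among invertible matrices, so a point
   outside has a neighbourhood outside. *)
move=> h uh not_orb.
have nspl : ~ splits_at i h.
  move=> spl_h; apply: not_orb; split=> //.
  exact: (@splits_at_same_orbit _ _ i g h hg uh spl_g spl_h).
have [[e1 e2] e_gt0 near_h] := not_splits_at_near uh nspl.
(* A positive element of [R[i]] has zero imaginary part, so the radius is the real number [e1]. *)
move: e_gt0; rewrite ltcE /= => /andP[/eqP e2_0 e1_gt0].
exists e1; split=> // h' uh' close [_ orb'].
apply: (near_h h' uh') => [p q|]; first by rewrite e2_0; exact: close.
exact: (@same_orbit_splits_at _ _ i g h' hg uh' orb' spl_g).
Qed.
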